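(* Let $\mathcal{H}$ be a strongly connected $d$-uniform hypergraph. Then any two distinct exact transversals of $\mathcal{H}$ are disjoint.
   Context: A $d$-uniform hypergraph consists of a vertex set and a family of edges, each a $d$-element subset of the vertex set. $\mathcal{H}$ is strongly connected if for every pair of edges $e,f$ there is a finite sequence of edges $e=e^{(0)},e^{(1)},\dots,e^{(n)}=f$ in which consecutive edges have symmetric difference of cardinality two. An exact transversal of $\mathcal{H}$ is a set of vertices meeting each edge in exactly one vertex.
   Formalization: The formal theorem additionally assumes that every vertex lies in some edge; without this the claim fails, e.g. vertices a, b with the single edge {a} have the distinct exact transversals {a} and {a,b}, which share a. *)

(* Defs.v *)
From mathcomp Require Import all_boot.
From mathcomp Require Import boolp classical_sets functions cardinality.

Set Implicit Arguments.
Unset Strict Implicit.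
Unset Printing Implicit Defensive.

Local Open Scope classical_set_scope.
Local Open Scope card_scope.

(* A hypergraph is given by its vertex set, the (possibly infinite) type V, and
   its set of edges E : set (set V). *)

Definition uniform (V : Type) (d : nat) (E : set (set V)) : Prop :=
  forall e, E e -> e #= `I_d.

(* The usual convention that the vertex set is the union of the edges.  A vertex
   in no edge may be added to a nonempty exact transversal T to get another one,
   which is not disjoint from T. *)
Definition no_isolated_vertex (V : Type) (E : set (set V)) : Prop :=
  forall v : V, exists2 e, E e & e v.

(* The chain e^(0), ..., e^(n) is a function s : nat -> set V of which only the
   values at 0, ..., n matter; `+` is the symmetric difference. *)
Definition strongly_connected (V : Type) (E : set (set V)) : Prop :=
  forall e f, E e -> E f ->
    exists (n : nat) (s : nat -> set V),
      [/\ s 0 = e, s n = f,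
          forall i, i <= n -> E (s i) &
          forall i, i < n -> (s i `+` s i.+1) #= `I_2].

Definition exact_transversal (V : Type) (E : set (set V)) (T : set V) : Prop :=
  forall e, E e -> exists! v, (T `&` e) v.

(* Main.v *)
Require Import Defs.
From mathcomp Require Import all_boot.
From mathcomp Require Import boolp classical_sets functions cardinality.
Local Open Scope classical_set_scope.

(** Suppose [T] and [T'] share a vertex; it lies in some edge. The property that an edge contains a
    common point of [T] and [T'] passes to adjacent edges ([common_point_adjacent]), hence along
    chains to every edge. By exactness that common point is the only point of [T], and of [T'], in
    the edge. Since the edges cover the vertices, [T = T']. *)

Lemma card_I2_no_triple {V : Type} {A : set V} {x y z : V} :
  (A #= `I_2)%card -> A x -> A y -> A z -> x <> y -> x <> z -> y = z.
Proof.
move=> /card_set_bijP[f [fI finj _]] Ax Ay Az xy xz.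
have fneq u v : A u -> A v -> u <> v -> f u <> f v.
  by move=> Au Av uv fuv; apply: uv; apply: finj => //; rewrite inE.
apply: contrapT => yz.
(* Pigeonhole: three pairwise distinct images would have to fit below 2. *)
have := fI _ Ax; have := fI _ Ay; have := fI _ Az => /=.
have := fneq _ _ Ax Ay xy; have := fneq _ _ Ax Az xz; have := fneq _ _ Ay Az yz.
by case: (f x) => [|[|?]]; case: (f y) => [|[|?]]; case: (f z) => [|[|?]].
Qed.

Lemma exact_transversal_eq {V : Type} {E : set (set V)} {T e : set V} {x y : V} :
  exact_transversal E T -> E e -> T x -> e x -> T y -> e y -> x = y.
Proof.
by move=> hT /hT[w [_ wP]] Tx ex Ty ey; rewrite -(wP x)// -(wP y).
Qed.

(* If v is a common point in e but not in f, the points of T and T' in f lie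
   outside e, hence with v in the two-element set e `+` f, so they coincide. *)
Lemma common_point_adjacent {V : Type} {E : set (set V)} {T T' e f : set V} :
  exact_transversal E T -> exact_transversal E T' -> E e -> E f ->
  ((e `+` f) #= `I_2)%card ->
  T `&` T' `&` e !=set0 -> T `&` T' `&` f !=set0.
Proof.
move=> hT hT' Ee Ef ef2 [v [[Tv T'v] ev]].
have [fv|nfv] := pselect (f v); first by exists v.
have [[t [[Tt ft] _]] [t' [[T't' ft'] _]]] := (hT f Ef, hT' f Ef).
have vt : v <> t by move=> vt; apply: nfv; rewrite vt.
have vt' : v <> t' by move=> vt'; apply: nfv; rewrite vt'.
have net : ~ e t.
  by move=> et; apply: vt; exact: (exact_transversal_eq hT Ee).
have net' : ~ e t'.
  by move=> et'; apply: vt'; exact: (exact_transversal_eq hT' Ee).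
have tt' : t = t'.
  by apply: (card_I2_no_triple ef2 _ _ _ vt vt'); [left|right|right].
by exists t; split=> //; split=> //; rewrite tt'.
Qed.

Lemma common_point_connected {V : Type} {E : set (set V)} {T T' e f : set V} :
  strongly_connected E -> exact_transversal E T -> exact_transversal E T' ->
  E e -> E f -> T `&` T' `&` e !=set0 -> T `&` T' `&` f !=set0.
Proof.
move=> hconn hT hT' Ee Ef; have [n [s [<- <- sE s2]]] := hconn e f Ee Ef.
(* The bound [i <= n] stays inside the induction, since [s] is constrained only up to [n]. *)
move=> s0; suff /(_ n (leqnn n)) : forall i, i <= n ->
  T `&` T' `&` s i !=set0 by [].
elim=> [//|i IH] ltin.
by apply: (common_point_adjacent hT hT' (sE i (ltnW ltin)) (sE _ ltin)
  (s2 i ltin)); apply: IH; exact: ltnW.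
Qed.

(** An edge through [x] contains a common point [w], and exactness of [T] forces [x = w]. The
    reverse inclusion follows by exchanging [T] and [T']. *)
Lemma meeting_transversals_subset {V : Type} {E : set (set V)} {T T' : set V} :
  no_isolated_vertex E -> strongly_connected E ->
  exact_transversal E T -> exact_transversal E T' ->
  T `&` T' !=set0 -> T `<=` T'.
Proof.
move=> hcover hconn hT hT' [v Tv] x Tx.
have [[e Ee ev] [f Ef fx]] := (hcover v, hcover x).
have [|w [[Tw T'w] fw]] := common_point_connected hconn hT hT' Ee Ef.
  by exists v.
by rewrite (exact_transversal_eq hT Ef Tx fx Tw fw).
Qed.

Theorem theorem4p1 (V : Type) (d : nat) (E : set (set V))
    (hcover : no_isolated_vertex E) (hunif : uniform d E)
    (hconn : strongly_connected E)
    (T T' : set V) (hT : exact_transversal E T) (hT' : exact_transversal E T')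
    (hneq : T <> T') :
  T `&` T' = set0.
Proof.
apply: contrapT => /eqP/set0P TT'; apply: hneq.
apply/seteqP; split; apply: meeting_transversals_subset hcover hconn _ _ _ => //.
by rewrite setIC.
Qed.
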